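(* Fix the monomial basis $\{x_0^2, x_0x_1, \dots, x_3^2, x_0\lambda, x_1\lambda, x_2\lambda, x_3\lambda, \lambda^2\}$ of $\mathbb{C}[x_0,\dots,x_3,\lambda]_2$. The morphism $\mathrm{Sym}^2\mathbb{C}^4\otimes\mathbb{C}^4 \to \mathrm{Gr}(3,\mathbb{P}^{14})$ given by $\mathcal{T}\mapsto [H_{\mathcal{T}}]$ is an isomorphism onto its image. In the Plücker coordinates with respect to this basis, this image is the subscheme of the Grassmannian consisting of the $3$-planes $H$ satisfying the following conditions, where $H$ is represented by a $4\times 15$ matrix whose rows span $H$ and whose columns are labelled by the monomial basis: (1) all the entries of the column corresponding to $\lambda^2$ are zero; and (2) the Plücker coordinate corresponding to the columns labelled by $\{x_0\lambda, x_1\lambda, x_2\lambda, x_3\lambda\}$ is non-zero. Moreover, if $\nu_2:\mathbb{P}^4\hookrightarrow\mathbb{P}^{14}$ is the Veronese embedding, then $\nu_2(\widetilde{E}(\mathcal{T})) = H_{\mathcal{T}}^{\vee}\cap \nu_2(\mathbb{P}^4)$ for every $\mathcal{T}\in \mathrm{Sym}^2\mathbb{C}^4\otimes\mathbb{C}^4$.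
   Context: An element $\mathcal{T}\in\mathrm{Sym}^2\mathbb{C}^{4}\otimes\mathbb{C}^{4}$ (a partially symmetric tensor) is identified with a tuple $(q_0,q_1,q_2,q_3)$ of quadratic forms in $\mathbb{C}[x_0,\dots,x_3]_2$, via the contraction $\mathcal{T}\cdot(x\otimes x)=(q_0(x),\dots,q_3(x))$; $\mathrm{Sym}^2\mathbb{C}^4\otimes\mathbb{C}^4$ is regarded as an affine space. The polynomials $q_i-\lambda x_i$ ($i=0,\dots,3$) are linearly independent, and $H_{\mathcal{T}}:=\mathrm{Span}_{\mathbb{C}}(q_0-\lambda x_0,\dots,q_3-\lambda x_3)$ is viewed as a projective $3$-plane in $\mathbb{P}^{14}=\mathbb{P}(\mathbb{C}[x_0,\dots,x_3,\lambda]_2)$. $\mathrm{Gr}(3,\mathbb{P}^{14})$ is the Grassmannian of projective $3$-planes in $\mathbb{P}^{14}$, and $[H_{\mathcal{T}}]$ is the corresponding point. The scheme of eigenpairs is $\widetilde{E}(\mathcal{T})=V(q_0-\lambda x_0,\dots,q_3-\lambda x_3)\subset\mathbb{P}^4=\mathrm{Proj}\,\mathbb{C}[x_0,\dots,x_3,\lambda]$. The Veronese embedding $\nu_2$ is the degree-2 Veronese embedding of this $\mathbb{P}^4$ into the dual projective space of $\mathbb{P}(\mathbb{C}[x_0,\dots,x_3,\lambda]_2)$ (so hyperplane sections of $\nu_2(\mathbb{P}^4)$ correspond to quadrics in $\mathbb{P}^4$), and $H_{\mathcal{T}}^{\vee}$ is the dual $10$-plane, i.e. the linear subspace of points annihilated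 by all the quadrics in $H_{\mathcal{T}}$. *)

(* Defs.v *)
From HB Require Import structures.
From mathcomp Require Import all_boot all_order all_algebra.
From mathcomp Require Import boolp classical_sets functions reals.
From mathcomp Require Import complex mpoly.

Set Implicit Arguments.
Unset Strict Implicit.
Unset Printing Implicit Defensive.

Import GRing.Theory.
Local Open Scope classical_set_scope.
Local Open Scope ring_scope.

(** Schemes over [k] are handled through their functors of points on
    commutative [k]-algebras.  Nothing is lost by the convention [1 != 0] of
    [comAlgType], since a scheme has exactly one point over the zero ring. *)

(* The points over [A] are the elements of [points A]; [ambient A] is only the
   type in which they live. *)
Record kfunctor (k : comNzRingType) := KFunctor {
  ambient : comAlgType k -> Type;
  points : forall A : comAlgType k, set (ambient A);
  pull : forall A B : comAlgType k, {lrmorphism A -> B} -> ambient A -> ambient B;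
  pull_points : forall (A B : comAlgType k) (f : {lrmorphism A -> B}) x,
    points x -> points (pull f x);
  pull_id : forall (A : comAlgType k) (x : ambient A),
    points x -> pull (idfun : {lrmorphism A -> A}) x = x;
  pull_comp : forall (A B C : comAlgType k)
      (f : {lrmorphism A -> B}) (g : {lrmorphism B -> C}) x,
    points x -> pull (g \o f : {lrmorphism A -> C}) x = pull g (pull f x)
}.

Arguments points {k} X A : rename.
Arguments pull {k} X {A B} f x : rename.

Definition subpoints (k : comNzRingType) (X : kfunctor k) :=
  forall A : comAlgType k, set (ambient X A).

(* By Yoneda's lemma, a family of maps natural in the algebra is the same thing
   as a morphism of schemes, and it is an isomorphism of [X] onto the subscheme
   [Z] of [Y] iff it is bijective from [X A] to [Z A] for every [A]. *)
Definition is_morphism (k : comNzRingType) (X Y : kfunctor k)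
    (phi : forall A : comAlgType k, ambient X A -> ambient Y A) : Prop :=
  (forall (A : comAlgType k) x, points X A x -> points Y A (phi A x)) /\
  (forall (A B : comAlgType k) (f : {lrmorphism A -> B}) x,
     points X A x -> phi B (pull X f x) = pull Y f (phi A x)).

Definition is_iso_onto (k : comNzRingType) (X Y : kfunctor k)
    (phi : forall A : comAlgType k, ambient X A -> ambient Y A)
    (Z : subpoints Y) : Prop :=
  forall A : comAlgType k, set_bij (points X A) (Z A) (phi A).

(* For each point [x : Spec A -> X], the preimage of [Z] is the closed subscheme
   of [Spec A] cut out by a set [I] of functions, resp. the open subscheme
   complementary to it. *)
Definition is_closed_sub (k : comNzRingType) (X : kfunctor k)
    (Z : subpoints X) : Prop :=
  (forall A, Z A `<=` points X A) /\
  forall (A : comAlgType k) x, points X A x ->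
  exists I : set A, forall (B : comAlgType k) (f : {lrmorphism A -> B}),
    Z B (pull X f x) <-> (forall a, I a -> f a = 0).

Definition is_open_sub (k : comNzRingType) (X : kfunctor k)
    (U : subpoints X) : Prop :=
  (forall A, U A `<=` points X A) /\
  forall (A : comAlgType k) x, points X A x ->
  exists I : set A, forall (B : comAlgType k) (f : {lrmorphism A -> B}),
    U B (pull X f x) <->
    exists m (b : 'I_m -> B) (a : 'I_m -> A),
      (forall i, I (a i)) /\ \sum_i b i * f (a i) = 1.

Section Grassmannian.

Definition span (A : comNzRingType) n (S : set 'rV[A]_n) : set 'rV[A]_n :=
  [set w | exists m (b : 'rV[A]_m) (M : 'M[A]_(m, n)),
             (forall i, S (row i M)) /\ w = b *m M].

Definition row_span (A : comNzRingType) m n (M : 'M[A]_(m, n)) : set 'rV[A]_n :=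
  span [set row i M | i in [set: 'I_m]].

Definition base_change (A B : comNzRingType) n (f : {rmorphism A -> B})
    (H : set 'rV[A]_n) : set 'rV[B]_n :=
  span [set map_mx f v | v in H].

(* The [A]-points of the Grassmannian of [r]-dimensional linear subspaces of an
   [n]-dimensional space: direct summands of [A^n] (i.e. images of idempotents)
   whose fibre at each field-valued point of [Spec A] has dimension [r]. *)
Definition grass (A : comNzRingType) (n r : nat) : set (set 'rV[A]_n) :=
  [set H | exists P : 'M[A]_n,
     [/\ P *m P = P, H = row_span P &
         forall (K : fieldType) (f : {rmorphism A -> K}),
           \rank (map_mx f P) = r]].

Lemma row_spanE (A : comNzRingType) m n (M : 'M[A]_(m, n)) :
  row_span M = [set b *m M | b in [set: 'rV[A]_m]].
Proof.
apply/seteqP; split => [w [p [b [N [hN ->]]]] | w [b _ <-]]; last first.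
  by exists m, b, M; split => // i; exists i.
have /choice [s hs] : forall i, exists j, row j M = row i N.
  by move=> i; have [j _ e] := hN i; exists j.
have -> : N = rowsub s 1%:M *m M.
  rewrite mul_rowsub_mx mul1mx; apply/row_matrixP => i.
  by rewrite row_rowsub hs.
by exists (b *m rowsub s 1%:M) => //; rewrite mulmxA.
Qed.

Lemma base_change_row_span (A B : comNzRingType) m n (f : {rmorphism A -> B})
    (M : 'M[A]_(m, n)) :
  base_change f (row_span M) = row_span (map_mx f M).
Proof.
rewrite !row_spanE; apply/seteqP; split => [w [p [b [N [hN ->]]]] | w [b _ <-]].
  have /choice [c hc] : forall i, exists c : 'rV[A]_m,
      row i N = map_mx f (c *m M).
    by move=> i; have [v [c _ <-] <-] := hN i; exists c.
  exists (b *m map_mx f (\matrix_i c i)) => //.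
  rewrite -mulmxA -map_mxM; congr (_ *m _); apply/row_matrixP => i.
  by rewrite -map_row row_mul rowK hc.
exists m, b, (map_mx f M); split => // i; rewrite -map_row.
exists (row i M) => //; exists (delta_mx 0 i) => //; exact: esym (rowE _ _).
Qed.

Variables (k : comNzRingType) (n r : nat).

Fact grass_pull (A B : comAlgType k) (f : {lrmorphism A -> B}) H :
  @grass A n r H -> @grass B n r (base_change f H).
Proof.
move=> [P [PP -> rP]]; exists (map_mx f P); split.
- by rewrite -map_mxM PP.
- exact: base_change_row_span.
- by move=> K g; rewrite -map_mx_comp; exact: (rP K (g \o f)).
Qed.

Fact grass_id (A : comAlgType k) H : @grass A n r H ->
  base_change (idfun : {lrmorphism A -> A}) H = H.
Proof.
by move=> [P [_ -> _]]; rewrite base_change_row_span map_mx_id.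
Qed.

Fact grass_comp (A B C : comAlgType k)
    (f : {lrmorphism A -> B}) (g : {lrmorphism B -> C}) H : @grass A n r H ->
  base_change (g \o f : {lrmorphism A -> C}) H
  = base_change g (base_change f H).
Proof.
by move=> [P [_ -> _]]; rewrite !base_change_row_span map_mx_comp.
Qed.

Definition Gr : kfunctor k :=
  @KFunctor k (fun A => set 'rV[A]_n) (fun A => @grass A n r)
    (fun A B f => base_change f) grass_pull grass_id grass_comp.

End Grassmannian.

Section Tensors.

Definition tensor (A : comNzRingType) := {ffun 'I_4 * 'I_4 * 'I_4 -> A}.

Definition psym (A : comNzRingType) : set (tensor A) :=
  [set T | forall i j l, T (i, j, l) = T (j, i, l)].

Definition map_tensor (A B : comNzRingType) (f : A -> B) (T : tensor A) :
  tensor B := [ffun ijl => f (T ijl)].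

Variable k : comNzRingType.

Fact psym_pull (A B : comAlgType k) (f : {lrmorphism A -> B}) T :
  psym T -> psym (map_tensor f T).
Proof. by move=> hT i j l; rewrite !ffunE hT. Qed.

Fact psym_id (A : comAlgType k) (T : tensor A) : psym T ->
  map_tensor (idfun : {lrmorphism A -> A}) T = T.
Proof. by move=> _; apply/ffunP => i; rewrite ffunE. Qed.

Fact psym_comp (A B C : comAlgType k)
    (f : {lrmorphism A -> B}) (g : {lrmorphism B -> C}) (T : tensor A) :
  psym T ->
  map_tensor (g \o f : {lrmorphism A -> C}) T = map_tensor g (map_tensor f T).
Proof. by move=> _; apply/ffunP => i; rewrite !ffunE. Qed.

(* The affine space [Sym^2 k^4 (x) k^4]. *)
Definition Sym2T : kfunctor k :=
  @KFunctor k (fun A => tensor A) (fun A => @psym A)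
    (fun A B f => map_tensor f) psym_pull psym_id psym_comp.

End Tensors.

(** The variables [x_0, .., x_3, lambda] are ['X_0, .., 'X_4]. *)

Definition xvar (i : 'I_4) : 'I_5 := widen_ord (leqnSn 4) i.
Definition lam : 'I_5 := ord_max.

Definition eigenform (A : comNzRingType) (T : tensor A) (l : 'I_4) : {mpoly A[5]} :=
  \sum_i \sum_j T (i, j, l) *: ('X_(xvar i) * 'X_(xvar j)) - 'X_lam * 'X_(xvar l).

Definition basis_pairs : 15.-tuple (nat * nat) :=
  [tuple (0, 0); (0, 1); (0, 2); (0, 3); (1, 1); (1, 2); (1, 3); (2, 2); (2, 3);
         (3, 3); (0, 4); (1, 4); (2, 4); (3, 4); (4, 4)]%N.

Definition basis_mnm (c : 'I_15) : 'X_{1..5} :=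
  (U_(inord (tnth basis_pairs c).1) + U_(inord (tnth basis_pairs c).2))%MM.

Definition col_xlam (i : 'I_4) : 'I_15 := inord (10 + i).
Definition col_lamlam : 'I_15 := ord_max.

Lemma basis_mnm_xlam i : basis_mnm (col_xlam i) = (U_(xvar i) + U_(lam))%MM.
Proof.
rewrite /basis_mnm (tnth_nth (0, 0)%N) inordK; last by case: i => -[|[|[|[|]]]].
by congr (U_(_) + U_(_))%MM; apply: val_inj; rewrite /= inordK;
  case: i => -[|[|[|[|]]]].
Qed.

Lemma basis_mnm_lamlam : basis_mnm col_lamlam = (U_(lam) + U_(lam))%MM.
Proof.
by rewrite /basis_mnm (tnth_nth (0, 0)%N); congr (U_(_) + U_(_))%MM;
  apply: val_inj; rewrite /= inordK.
Qed.

Lemma basis_mnm_inj : injective basis_mnm.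
Proof.
pose w (c : 'I_15) := [seq ((tnth basis_pairs c).1 == i) +
  ((tnth basis_pairs c).2 == i) | i <- iota 0 5]%N.
have tP c : ((tnth basis_pairs c).1 < 5)%N && ((tnth basis_pairs c).2 < 5)%N.
  by have := mem_tnth c basis_pairs; apply/allP: (tnth basis_pairs c).
have wE c : w c = [seq basis_mnm c (inord i) | i <- iota 0 5].
  have /andP[h1 h2] := tP c.
  apply/eq_in_map => i; rewrite mem_iota /= => hi.
  by rewrite /basis_mnm mnmDE !mnm1E -!val_eqE /= !inordK.
move=> c d e; have : w c = w d by rewrite !wE e.
rewrite /w !(tnth_nth (0, 0)%N) => {wE e}.
by case: c d => -[|[|[|[|[|[|[|[|[|[|[|[|[|[|[|//]]]]]]]]]]]]]]] hc
  [[|[|[|[|[|[|[|[|[|[|[|[|[|[|[|//]]]]]]]]]]]]]]] hd] //= _; apply: val_inj.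
Qed.

(* The coordinates of a quadratic form in [x_0, .., x_3, lambda]. *)
Definition coef_row (A : comNzRingType) (p : {mpoly A[5]}) : 'rV[A]_15 :=
  \row_c p@_(basis_mnm c).

Definition eigenplane (A : comNzRingType) (T : tensor A) : set 'rV[A]_15 :=
  span [set coef_row (eigenform T l) | l in [set: 'I_4]].

(* A point of the Grassmannian over [A] is represented by a matrix only locally
   on [Spec A], so the conditions below are about the matrices over algebras
   over [A] that represent it there. *)
Definition represents (A : comNzRingType) (M : 'M[A]_(4, 15))
    (H : set 'rV[A]_15) : Prop := row_span M = H.

Definition plucker (A : comNzRingType) (M : 'M[A]_(4, 15)) (J : 'I_4 -> 'I_15) : A :=
  \det (colsub J M).

Definition zero_lamlam (k : comNzRingType) : subpoints (Gr k 15 4) :=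
  fun A => [set H | grass 4 H /\
    forall (B : comNzRingType) (f : {rmorphism A -> B}) (M : 'M[B]_(4, 15)),
      represents M (base_change f H) -> forall i, M i col_lamlam = 0].

(* A homogeneous coordinate is non-zero on [Spec A] when it is non-zero at each
   of its field-valued points. *)
Definition nonzero_xlam (k : comNzRingType) : subpoints (Gr k 15 4) :=
  fun A => [set H | grass 4 H /\
    forall (K : fieldType) (f : {rmorphism A -> K}) (M : 'M[K]_(4, 15)),
      represents M (base_change f H) -> plucker M col_xlam != 0].

(** Closed subschemes of [P^4] and of [P^14]; the projective space [P^n] is
    [Gr k n.+1 1], and the [P^14] below is dual to the one containing
    [eigenplane T], with coordinates dual to the monomial basis. *)

(* The common zero scheme [V(eigenform T 0, .., eigenform T 3)]: a form vanishes
   on the line [L] when it vanishes at all the vectors of [L]. *)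
Definition eigenscheme (k : comNzRingType) (T : tensor k) : subpoints (Gr k 5 1) :=
  fun A => [set L | grass 1 L /\
    forall v, L v -> forall l, mmap (in_alg A) (v 0) (eigenform T l) = 0].

Definition veronese_vec (A : comNzRingType) (v : 'rV[A]_5) : 'rV[A]_15 :=
  \row_c \prod_(i < 5) v 0 i ^+ basis_mnm c i.

Definition veronese (A : comNzRingType) (L : set 'rV[A]_5) : set 'rV[A]_15 :=
  span [set veronese_vec v | v in L].

Definition dual_plane (k : comNzRingType) (H : set 'rV[k]_15) :
    subpoints (Gr k 15 1) :=
  fun A => [set L | grass 1 L /\
    forall z, L z -> forall h, H h -> \sum_c h 0 c *: z 0 c = 0].

(* Main.v *)
Require Import Defs.
From HB Require Import structures.
From mathcomp Require Import all_boot all_order all_algebra.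
From mathcomp Require Import boolp classical_sets functions reals.
From mathcomp Require Import complex mpoly.
From mathcomp Require Import ring.
Set Implicit Arguments.
Unset Strict Implicit.
Unset Printing Implicit Defensive.
Import GRing.Theory.
Local Open Scope classical_set_scope.
Local Open Scope ring_scope.

(** Over any algebra, [eigenplane T] is the row span of the matrix [(Q | -1 | 0)]
    whose block [Q] holds the coefficients of the quadrics (doubled off the
    diagonal), so [T] can be read off the plane, and conversely a plane with a
    basis of the form [(Q | -1 | 0)] is an eigenplane.  A plane [H] is the image
    of an idempotent [P] of rank 4 at every field-valued point.  If the Plücker
    coordinate vanishes at no such point, the minors of [P] with columns
    [x_i lambda] generate the unit ideal (otherwise they all vanish in some
    residue field), and by Cramer's rule the whole of [H] has a basis with block
    [-1] in these columns.  The condition on the column [lambda^2] is tested by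
    inverting a minor of [P], since [H] then becomes free.  For the Veronese
    embedding, [Sym^2] of a rank one idempotent is an idempotent of rank one whose
    image is spanned by the squares of the vectors of the line, and a quadric
    evaluated at [v] is the pairing of its coefficients with [veronese_vec v]. *)

Local Notation span := Defs.span.

(** * Quotients and residue fields *)

Definition is_ideal (R : comNzRingType) (I : set R) : Prop :=
  I 0 /\ forall a u v, I u -> I v -> I (a * u + v).

(** Properness of [I] is what makes 1 nonzero in the quotient, as [comNzRingType] demands. *)
Lemma exists_quotient (R : comNzRingType) (I : set R) :
  is_ideal I -> ~ I 1 ->
  exists (Q : comNzRingType) (p : {rmorphism R -> Q}),
    (forall q, exists x, p x = q) /\ (forall x, p x = 0 <-> I x).
Proof.
move=> [I0 IM] I1; pose S : {pred R} := fun x => `[< I x >].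
have clS : idealr_closed S.
  split; [exact/asboolP | exact/asboolP | ].
  by move=> a u v /asboolP Iu /asboolP Iv; apply/asboolP/IM.
pose J : idealr R := HB.pack (S : R -> bool) (@isIdealr.Build R S clS).
exists {ideal_quot J}, (\pi_{ideal_quot J})%qT; split=> [q|x].
  by exists (repr q); exact: reprK.
have -> : ((\pi_{ideal_quot J} x)%qT = 0) <-> (x \in J).
  rewrite -{2}[x]subr0 Quotient.idealrBE.
  by rewrite -(rmorph0 (\pi_{ideal_quot J})%qT); split=> /eqP.
by split=> /asboolP.
Qed.

(** Maximality is phrased as invertibility modulo [M], the form that turns the quotient into a
    field. *)
Lemma exists_maximal_ideal (R : comNzRingType) (I : set R) :
  is_ideal I -> ~ I 1 ->
  exists M : set R, [/\ is_ideal M, ~ M 1, I `<=` M &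
    forall x, ~ M x -> exists a m, M m /\ 1 = a * x + m].
Proof.
move=> idI I1.
pose P (J : set R) := J = set0 \/ [/\ is_ideal J, ~ J 1 & I `<=` J].
have [|M [PM maxM]] := @Zorn_bigcup R P.
  move=> F FP tot.
  have [[X [FX X0]]|none] := pselect (exists X, F X /\ X !=set0); last first.
    left; rewrite -subset0 => x [X FX Xx]; case: none.
    by exists X; split => //; exists x.
  have good Y y : F Y -> Y y -> [/\ is_ideal Y, ~ Y 1 & I `<=` Y].
    by move=> FY Yy; have [Y0|//] := FP Y FY; rewrite Y0 in Yy.
  case: X0 => x Xx; have [idX _ IX] := good X x FX Xx.
  right; split.
  - split; first by exists X => //; case: idX.
    move=> a u v [U FU Uu] [V FV Vv].
    have [[_ hU] _ _] := good U u FU Uu; have [[_ hV] _ _] := good V v FV Vv.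
    by have [UV|VU] := tot U V FU FV; [exists V => //; apply/hV/Vv/UV|
      exists U => //; apply/hU/VU].
  - by move=> [Y FY Y1]; have [_ /(_ Y1)] := good Y 1 FY Y1.
  - by move=> y Iy; exists X => //; exact: IX.
have {PM} [M0|[idM M1 IM]] := PM.
  case: (maxM I); last by right; split.
  by rewrite M0; split => // /(_ 0); case: idI => I0 _ /(_ I0).
exists M; split => // x Mx; apply: contrapT => noinv.
have [M0 MM] := idM.
(* The ideal generated by [M] and [x]: if [x] had no inverse modulo [M], it would be proper and
   strictly larger than [M]. *)
pose J := [set y | exists a m, M m /\ y = a * x + m].
apply: (maxM J); last right.
  split => [|JM]; last by apply: Mx; apply: JM; exists 1, 0; rewrite mul1r addr0.
  by move=> y My; exists 0, y; rewrite mul0r add0r.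
split => [||y Iy]; [split|..].
- by exists 0, 0; rewrite mul0r add0r.
- move=> c _ _ [a [m [Mm ->]]] [b [n [Mn ->]]]; exists (c * a + b), (c * m + n).
  by split; [exact: MM | rewrite !mulrDr mulrDl mulrA addrACA].
- by move=> [a [m J1]]; apply: noinv; exists a, m.
- by exists 0, y; rewrite mul0r add0r; split => //; exact: IM.
Qed.

Lemma exists_residue_field (R : comNzRingType) (I : set R) :
  is_ideal I -> ~ I 1 ->
  exists (K : fieldType) (f : {rmorphism R -> K}), forall x, I x -> f x = 0.
Proof.
move=> idI I1; have [M [idM M1 IM maxM]] := exists_maximal_ideal idI I1.
have [Q [p [psurj pker]]] := exists_quotient idM M1.
(* The field structure expects a total inverse with value 0 at 0. *)
have /choice [inv inv_spec] : forall q : Q, exists r,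
    (q != 0 -> r * q = 1) /\ (q = 0 -> r = 0).
  move=> q; have [->|q0] := eqVneq q 0; first by exists 0.
  have [x xq] := psurj q.
  have [|a [m [Mm a1]]] := maxM x; first by rewrite -pker xq; apply/eqP.
  exists (p a); split => [_|/eqP]; last by rewrite (negPf q0).
  by rewrite -xq -rmorphM -(rmorph1 p) a1 rmorphD /= (pker m).2 // addr0.
pose K : fieldType := HB.pack (GRing.ComNzRing.sort Q) (@GRing.ComNzRing_isField.Build Q inv
  (fun q => (inv_spec q).1) ((inv_spec 0).2 erefl)).
by exists K, p => x /IM /pker.
Qed.

(* The localization is [R[X] / (s X - 1)]: if [a = g (s X - 1)], then
   [g_i = - s^i a] for all [i]. *)
Lemma exists_localization (R : comNzRingType) (s a : R) :
  (forall n, s ^+ n * a != 0) ->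
  exists (L : comNzRingType) (f : {rmorphism R -> L}) (t : L),
    t * f s = 1 /\ f a != 0.
Proof.
move=> sa; pose d : {poly R} := s *: 'X - 1.
pose I := [set p : {poly R} | exists g, p = g * d].
have Ia : ~ I a%:P.
  move=> [g ag]; have gE n : g`_n = - (s ^+ n * a).
    elim: n => [|n IHn].
      have := congr1 (fun p : {poly R} => p`_0) ag.
      rewrite coefC mulrBr mulr1 -scalerAr coefB coefZ coefMX /= mulr0 sub0r.
      by rewrite mul1r => ->; rewrite opprK.
    have := congr1 (fun p : {poly R} => p`_n.+1) ag.
    rewrite coefC mulrBr mulr1 -scalerAr coefB coefZ coefMX /= IHn.
    by move/eqP; rewrite eq_sym subr_eq0 => /eqP <-; rewrite mulrN mulrA exprS.
  have /negP := sa (size g); apply.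
  by rewrite -oppr_eq0 -gE nth_default.
have idI : is_ideal I.
  split; first by exists 0; rewrite mul0r.
  by move=> c _ _ [g ->] [h ->]; exists (c * g + h); rewrite mulrDl mulrA.
have I1 : ~ I 1 by move=> [g g1]; apply: Ia; exists (a%:P * g); rewrite -mulrA -g1 mulr1.
have [L [p [_ pker]]] := exists_quotient idI I1.
exists L, (p \o polyC : {rmorphism R -> L}), (p 'X); split; last first.
  by apply/eqP; rewrite pker.
rewrite /= -rmorphM; apply/eqP; rewrite -subr_eq0 -(rmorph1 p) -rmorphB /=.
by apply/eqP/pker; exists 1; rewrite mul1r mulrC mul_polyC.
Qed.

(** * Row spans and points of Grassmannians *)

Lemma row_span_row (R : comNzRingType) m n (M : 'M[R]_(m, n)) i :
  row_span M (row i M).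
Proof. by rewrite row_spanE; exists (delta_mx 0 i) => //; exact: esym (rowE _ _). Qed.

Lemma row_span_mul (R : comNzRingType) p m n (A : 'M[R]_(p, m)) (M : 'M_(m, n)) :
  row_span (A *m M) `<=` row_span M.
Proof. by rewrite !row_spanE => w [b _ <-]; exists (b *m A); rewrite ?mulmxA. Qed.

Lemma row_span_factor (R : comNzRingType) p m n (N : 'M[R]_(p, n)) (M : 'M_(m, n)) :
  (forall i, row_span M (row i N)) -> exists A, N = A *m M.
Proof.
rewrite row_spanE => hN.
have /choice [b hb] : forall i, exists b, b *m M = row i N.
  by move=> i; have [b _ e] := hN i; exists b.
by exists (\matrix_i b i); apply/row_matrixP => i; rewrite row_mul rowK hb.
Qed.

Lemma row_span_fieldE (K : fieldType) m n (M : 'M[K]_(m, n)) w :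
  row_span M w <-> (w <= M)%MS.
Proof.
rewrite row_spanE; split=> [[b _ <-]|/submxP [b ->]]; first exact: submxMl.
by exists b.
Qed.

Lemma span_incl (R : comNzRingType) n (S : set 'rV[R]_n) : S `<=` span S.
Proof.
move=> w Sw; exists 1%N, 1%:M, w; rewrite mul1mx; split => // i.
by rewrite (ord1 i) rowE [delta_mx _ _]mx11_scalar mxE mul1mx.
Qed.

Lemma span0 (R : comNzRingType) n (S : set 'rV[R]_n) : span S 0.
Proof. by exists 0%N, 0, 0; rewrite mulmx0; split => // -[]. Qed.

Lemma spanD (R : comNzRingType) n (S : set 'rV[R]_n) u v :
  span S u -> span S v -> span S (u + v).
Proof.
move=> [p [b [M [hM ->]]]] [q [c [N [hN ->]]]].
exists (p + q)%N, (row_mx b c), (col_mx M N); rewrite mul_row_col; split => // i.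
by rewrite -(splitK i); case: (fintype.split i) => j; rewrite /= (rowKu, rowKd).
Qed.

Lemma spanZ (R : comNzRingType) n (S : set 'rV[R]_n) a v :
  span S v -> span S (a *: v).
Proof. by move=> [p [b [M [hM ->]]]]; exists p, (a *: b), M; rewrite scalemxAl. Qed.

Lemma span_sum (R : comNzRingType) n (S : set 'rV[R]_n) (I : finType)
    (P : pred I) (F : I -> 'rV_n) :
  (forall i, P i -> span S (F i)) -> span S (\sum_(i | P i) F i).
Proof. by move=> hF; elim/big_ind: _ => //; [exact: span0 | exact: spanD]. Qed.

Lemma row_span_sub_span (R : comNzRingType) m n (S : set 'rV[R]_n) (M : 'M_(m, n)) :
  (forall i, span S (row i M)) -> row_span M `<=` span S.
Proof.
rewrite row_spanE => hM w [b _ <-].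
by rewrite mulmx_sum_row; apply: span_sum => i _; exact: spanZ.
Qed.

Lemma span_sub_row_span (R : comNzRingType) m n (S : set 'rV[R]_n) (M : 'M_(m, n)) :
  S `<=` row_span M -> span S `<=` row_span M.
Proof.
move=> hS w [p [b [N [hN ->]]]].
have [A ->] := row_span_factor (fun i => hS _ (hN i)).
by rewrite row_spanE; exists (b *m A); rewrite ?mulmxA.
Qed.

(* [\det (1 - G)] is a unit: in a residue field where it vanished, [G] would also
   vanish, so that it would be [1]. *)
Lemma idempotent_eq0 (R : comNzRingType) n (G : 'M[R]_n) :
  G *m G = G ->
  (forall (K : fieldType) (f : {rmorphism R -> K}), map_mx f G = 0) -> G = 0.
Proof.
move=> GG G0; pose d := \det (1%:M - G); pose I := [set x | exists t, x = t * d].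
have [[t t1]|I1] := pselect (I 1).
  have : \adj (1%:M - G) *m (1%:M - G) *m G = 0.
    by rewrite -mulmxA mulmxBl mul1mx GG subrr mulmx0.
  rewrite mul_adj_mx mul_scalar_mx => dG.
  by rewrite -[G]scale1r t1 -scalerA dG scaler0.
have [|K [f f0]] := @exists_residue_field R I _ I1.
  split; first by exists 0; rewrite mul0r.
  by move=> a _ _ [t ->] [u ->]; exists (a * t + u); rewrite mulrDl mulrA.
have /eqP := f0 d (ex_intro _ 1 (esym (mul1r d))).
by rewrite -det_map_mx map_mxB map_mx1 G0 subr0 det1 oner_eq0.
Qed.

Lemma mxrank_section (K : fieldType) r n (N : 'M[K]_(r, n)) E :
  N *m E = 1%:M -> \rank N = r.
Proof. by move=> NE; apply/eqP/row_freeP; exists E. Qed.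

(* [P - P E N] is an idempotent of rank [r - r = 0] at every field-valued point. *)
Lemma idempotent_frame (R : comNzRingType) n r (P : 'M[R]_n) (N : 'M_(r, n)) E :
  P *m P = P ->
  (forall (K : fieldType) (f : {rmorphism R -> K}), \rank (map_mx f P) = r) ->
  N *m E = 1%:M -> N *m P = N -> row_span P = row_span N.
Proof.
move=> PP rP NE NP.
have ENEN : E *m N *m (E *m N) = E *m N by rewrite mulmxA -(mulmxA E) NE mulmx1.
have ENP : E *m N *m P = E *m N by rewrite -mulmxA NP.
have /eqP : P - P *m (E *m N) = 0.
  apply: idempotent_eq0 => [|K f].
    rewrite mulmxBl !mulmxBr PP (mulmxA P P) PP.
    by rewrite -(mulmxA P (E *m N)) ENP -(mulmxA P (E *m N)) (mulmxA (E *m N) P)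
      ENP ENEN subrr subr0.
  have fNE : map_mx f N *m map_mx f E = 1%:M by rewrite -map_mxM NE map_mx1.
  have fNP : map_mx f N *m map_mx f P = map_mx f N by rewrite -map_mxM NP.
  have sub : (map_mx f N <= map_mx f P)%MS by rewrite -fNP submxMl.
  have [_ ] := mxrank_leqif_eq sub; rewrite (mxrank_section fNE) rP eqxx.
  move=> /esym /andP [_ /submxP [X fPX]].
  by rewrite map_mxB !map_mxM fPX mulmxA -(mulmxA X) fNE mulmx1 subrr.
rewrite subr_eq0 mulmxA => /eqP PE; apply/seteqP; split.
  by rewrite PE; exact: row_span_mul.
by rewrite -{1}NP; exact: row_span_mul.
Qed.

(** [E] is a generalized inverse of [M], so [E *m M] is an idempotent with the same row span as [M]
    and the same rank at every field-valued point. *)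
Lemma grass_regular (R : comNzRingType) m n r (M : 'M[R]_(m, n)) E :
  M *m E *m M = M ->
  (forall (K : fieldType) (f : {rmorphism R -> K}), \rank (map_mx f M) = r) ->
  grass r (row_span M).
Proof.
move=> MEM rM; exists (E *m M); split => [||K f].
- by rewrite mulmxA -(mulmxA E) -(mulmxA E) MEM.
- apply/seteqP; split; last exact: row_span_mul.
  by rewrite -{1}MEM -mulmxA; exact: row_span_mul.
- apply/eqP; rewrite eqn_leq -{1}(rM K f) map_mxM mxrankM_maxr /=.
  by rewrite -{1}(rM K f) -{1}MEM -mulmxA map_mxM map_mxM mxrankM_maxr.
Qed.

Lemma grass_frame (R : comNzRingType) n r (N : 'M[R]_(r, n)) E :
  N *m E = 1%:M -> grass r (row_span N).
Proof.
move=> NE; apply: (@grass_regular _ _ _ _ _ E) => [|K f].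
  by rewrite NE mul1mx.
by apply: (@mxrank_section _ _ _ _ (map_mx f E)); rewrite -map_mxM NE map_mx1.
Qed.

(** * Minors, bases and Plücker coordinates *)

Lemma exists_minor (K : fieldType) m n r (A : 'M[K]_(m, n)) : \rank A = r ->
  exists (s : {ffun 'I_r -> 'I_m}) (t : {ffun 'I_r -> 'I_n}),
    \det (mxsub s t A) != 0.
Proof.
case: r /; have := maxrowsub_free A; set B := rowsub _ A => freeB.
have fullB : row_full B^T by rewrite /row_full mxrank_tr; exact: freeB.
exists [ffun i => maxrankfun A i], [ffun i => fullrankfun fullB i].
have := fullrowsub_unit fullB; rewrite unitmxE unitfE -det_tr; congr (_ != 0).
by congr (\det _); apply/matrixP => i j; rewrite !mxE !ffunE.
Qed.

(** The selection of rows is a finite function so that sums over all selections make sense. *)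
Lemma exists_row_minor (K : fieldType) m r (A : 'M[K]_(m, r)) : row_full A ->
  exists s : {ffun 'I_r -> 'I_m}, \det (rowsub s A) != 0.
Proof.
move=> fullA; exists [ffun i => fullrankfun fullA i].
have := fullrowsub_unit fullA; rewrite unitmxE unitfE; congr (_ != 0).
by congr (\det _); apply/matrixP => i j; rewrite !mxE !ffunE.
Qed.

(* If [v_c != 0], then since the maximal minors of [P] generate the unit ideal,
   [v_c] survives after inverting one of them, where [H] has a basis. *)
Lemma grass_zero_column (R : comNzRingType) n r (H : set 'rV[R]_n) (c : 'I_n) :
  grass r H ->
  (forall (B : comNzRingType) (f : {rmorphism R -> B}) (M : 'M[B]_(r, n)),
     row_span M = base_change f H -> forall i, M i c = 0) <->
  (forall v, H v -> v 0 c = 0).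
Proof.
move=> [P [PP HE rP]]; rewrite {H}HE; split => [zero v Pv|zero B f M MP i]; last first.
  have := row_span_row M i; rewrite MP base_change_row_span row_spanE => -[b _ bM].
  have -> : M i c = row i M 0 c by rewrite mxE.
  rewrite -bM mxE big1 // => j _; rewrite mxE.
  have := zero (row j P) (row_span_row P j).
  by rewrite mxE => ->; rewrite rmorph0 mulr0.
apply: contrapT => /eqP a0; set a := v 0 c in a0.
(* The annihilator of [a] is proper. In a residue field where it vanishes, some minor of [P] is
   nonzero, so no power of that minor kills [a]. *)
pose I := [set x | x * a = 0].
have idI : is_ideal I.
  rewrite /is_ideal /I /=; split; first by rewrite mul0r.
  by move=> x y z ya za; rewrite mulrDl -mulrA ya za mulr0 addr0.
have I1 : ~ I 1 by rewrite /I /= mul1r; apply/eqP.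
have [K [f f0]] := exists_residue_field idI I1.
have [s [t st]] := exists_minor (rP K f).
have [k|L [g [u [ug ga]]]] := @exists_localization R (\det (mxsub s t P)) a.
  apply: contraNneq st => /f0 /eqP.
  by rewrite rmorphXn expf_eq0 -det_map_mx map_mxsub => /andP [].
(* Over [L] the chosen minor is invertible with inverse [u], so Cramer's rule gives a right inverse
   [E] of the rows [s] of [P]. *)
pose N := rowsub s (map_mx g P); pose E := colsub t 1%:M *m (u *: \adj (colsub t N)).
have NE : N *m E = 1%:M.
  rewrite mulmxA mulmx_colsub mulmx1 -scalemxAr mul_mx_adj.
  rewrite scale_scalar_mx -[RHS]/(1%:M); congr _%:M.
  rewrite -ug -det_map_mx map_mxsub; congr (_ * \det _).
  by apply/matrixP => i j; rewrite !mxE.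
have gPP : map_mx g P *m map_mx g P = map_mx g P by rewrite -map_mxM PP.
have gP : row_span (map_mx g P) = row_span N.
  apply: (idempotent_frame gPP _ NE) => [K' h|].
    by rewrite -map_mx_comp; exact: (rP K' (h \o g)).
  by rewrite mul_rowsub_mx gPP.
have N0 := zero L g N; rewrite base_change_row_span gP in N0.
have : row_span N (map_mx g v).
  move: Pv; rewrite -gP !row_spanE => -[b _ <-].
  by exists (map_mx g b); rewrite ?map_mxM.
rewrite row_spanE => -[b _ bN]; case/negP: ga; apply/eqP.
have := congr1 (fun w : 'rV_n => w 0 c) bN; rewrite [RHS]mxE => <-.
by rewrite mxE big1 // => j _; rewrite N0 ?mulr0.
Qed.

Lemma exists_frame_field (K : fieldType) m n r (P : 'M[K]_(m, n)) :
  \rank P = r -> exists M : 'M[K]_(r, n), row_span M = row_span P.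
Proof.
case: r /; exists (row_base P); apply/seteqP; split=> w;
  by rewrite !row_span_fieldE (eq_row_base P).
Qed.

(** Each minor of [P] in the columns [J] is a multiple of that of a basis [M]. Conversely, if these
    minors generated a proper ideal, all would vanish in some residue field; there [M = X *m P] with
    [colsub J M] invertible forces the columns [J] of [P] to be independent. *)
Lemma grass_plucker_nonzero (R : comNzRingType) n r (P : 'M[R]_n) (J : 'I_r -> 'I_n) :
  (forall (K : fieldType) (f : {rmorphism R -> K}), \rank (map_mx f P) = r) ->
  (forall (K : fieldType) (f : {rmorphism R -> K}) (M : 'M[K]_(r, n)),
     row_span M = base_change f (row_span P) -> \det (colsub J M) != 0) <->
  exists b : {ffun 'I_r -> 'I_n} -> R, \sum_s b s * \det (mxsub s J P) = 1.
Proof.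
move=> rP; split => [nz|[b b1] K f M]; last first.
  rewrite base_change_row_span => MP; apply/negP => /eqP M0.
  have /eqP := rmorph1 f; rewrite -b1 rmorph_sum big1 ?(eq_sym 0) ?oner_eq0 //.
  move=> s _; rewrite rmorphM -det_map_mx map_mxsub.
  have [i|X XM] := @row_span_factor _ _ _ _ (rowsub s (map_mx f P)) M.
    by rewrite MP row_rowsub; exact: row_span_row.
  have -> : mxsub s J (map_mx f P) = X *m colsub J M.
    by rewrite mulmx_colsub -XM; apply/matrixP => i j; rewrite !mxE.
  by rewrite det_mulmx M0 !mulr0.
pose I := [set x | exists b : {ffun 'I_r -> 'I_n} -> R,
  x = \sum_s b s * \det (mxsub s J P)].
have [[b b1]|I1] := pselect (I 1); first by exists b.
have [|K [f f0]] := @exists_residue_field R I _ I1.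
  split; first by exists (fun=> 0); rewrite big1 // => s _; rewrite mul0r.
  move=> a _ _ [b ->] [c ->]; exists (fun s => a * b s + c s).
  rewrite mulr_sumr -big_split; apply: eq_bigr => s _.
  by rewrite mulrDl mulrA.
have [M MP] := exists_frame_field (rP K f).
have := nz K f M; rewrite base_change_row_span MP => /(_ erefl) M0.
have [i|X XM] := @row_span_factor _ _ _ _ M (map_mx f P).
  by rewrite -MP; exact: row_span_row.
have [|s s0] := @exists_row_minor _ _ _ (colsub J (map_mx f P)).
  apply/row_fullP; exists (invmx (colsub J M) *m X).
  by rewrite -mulmxA mulmx_colsub -XM mulVmx // unitmxE unitfE.
case/negP: s0; rewrite -(f0 (\det (mxsub s J P))).
  by rewrite -det_map_mx map_mxsub; apply/eqP; congr (\det _);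
    apply/matrixP => i j; rewrite !mxE.
exists (fun t => (t == s)%:R); rewrite (bigD1 s) //= eqxx mul1r big1 ?addr0 //.
by move=> t /negPf ->; rewrite mul0r.
Qed.

(** * Eigenplanes *)

Lemma mnmU2_eq n (a b c d : 'I_n) :
  (U_(a) + U_(b) == U_(c) + U_(d))%MM
  = ((a == c) && (b == d)) || ((a == d) && (b == c)).
Proof.
apply/eqP/orP => [e|[] /andP [/eqP -> /eqP ->] //]; last by rewrite addmC.
have /(congr1 (fun m : 'X_{1..n} => m a)) := e; rewrite !mnmDE !mnm1E eqxx.
have [ac|_] := eqVneq c a; last have [ad|_] := eqVneq d a; last by [].
- left; subst c; move/addmI: e => /eqP; rewrite eq_mnm1 => /eqP ->.
  by rewrite !eqxx.
- right; subst d; move: e; rewrite [X in _ = X]addmC => /addmI /eqP.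
  by rewrite eq_mnm1 => /eqP ->; rewrite !eqxx.
Qed.

(** The column of the product of the variables [i] and [j]; the pair is sorted because [basis_pairs]
    lists each monomial once. *)
Definition idx (i j : 'I_5) : 'I_15 := inord (index (minn i j, maxn i j) basis_pairs).

Lemma basis_mnm_idx i j : basis_mnm (idx i j) = (U_(i) + U_(j))%MM.
Proof.
suff H : (minn i j, maxn i j) \in (basis_pairs : seq _).
  rewrite /basis_mnm (tnth_nth (0, 0)%N) inordK; last first.
    by rewrite -[ltnRHS](size_tuple basis_pairs) index_mem.
  rewrite nth_index //=; case: (leqP i j) => ij; rewrite !inord_val //.
  exact: addmC.
by case: i j => -[|[|[|[|[|//]]]]] hi [[|[|[|[|[|//]]]]] hj].
Qed.

Lemma idxC i j : idx i j = idx j i.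
Proof. by apply: basis_mnm_inj; rewrite !basis_mnm_idx addmC. Qed.

Lemma idx_surj c : exists i j, c = idx i j.
Proof.
exists (inord (tnth basis_pairs c).1), (inord (tnth basis_pairs c).2).
by apply: basis_mnm_inj; rewrite basis_mnm_idx.
Qed.

Lemma col_xlamE i : col_xlam i = idx (xvar i) lam.
Proof. by apply: basis_mnm_inj; rewrite basis_mnm_xlam basis_mnm_idx. Qed.

Lemma col_lamlamE : col_lamlam = idx lam lam.
Proof. by apply: basis_mnm_inj; rewrite basis_mnm_lamlam basis_mnm_idx. Qed.

Lemma xvar_inj : injective xvar.
Proof. by move=> i j /(congr1 val) ij; apply: val_inj. Qed.

Lemma xvar_lam i : (xvar i == lam) = false.
Proof. by apply/negbTE; rewrite -val_eqE /= neq_ltn ltn_ord. Qed.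

Lemma var_cases (i : 'I_5) : i = lam \/ exists j, i = xvar j.
Proof.
have [i4|i4] := ltnP i 4; first by right; exists (Ordinal i4); apply: val_inj.
by left; apply: val_inj; apply/eqP; rewrite /= eqn_leq i4 -ltnS ltn_ord.
Qed.

(** The three blocks of columns of [(Q | -1 | 0)]. *)
Variant col_spec : 'I_15 -> Prop :=
  | ColXX i j : col_spec (idx (xvar i) (xvar j))
  | ColXLam i : col_spec (col_xlam i)
  | ColLamLam : col_spec col_lamlam.

Lemma colP c : col_spec c.
Proof.
have [i [j ->]] := idx_surj c.
have [->|[i' ->]] := var_cases i; have [->|[j' ->]] := var_cases j.
- by rewrite -col_lamlamE; constructor.
- by rewrite idxC -col_xlamE; constructor.
- by rewrite -col_xlamE; constructor.
- by constructor.
Qed.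

Section EigenMatrix.

Variable A : comNzRingType.
Implicit Type T : tensor A.

Definition eigenmx T : 'M[A]_(4, 15) := \matrix_l coef_row (eigenform T l).

Lemma eigenplaneE T : eigenplane T = row_span (eigenmx T).
Proof.
rewrite /eigenplane /row_span; congr (span _).
by apply: eq_imagel => l _; rewrite rowK.
Qed.

Lemma eigenmxE T l c : eigenmx T l c =
  \sum_i \sum_j T (i, j, l) * (U_(xvar i) + U_(xvar j) == basis_mnm c)%MM%:R
  - (U_(lam) + U_(xvar l) == basis_mnm c)%MM%:R.
Proof.
rewrite !mxE mcoeffB -mpolyXD mcoeffX; congr (_ - _).
rewrite raddf_sum; apply: eq_bigr => i _; rewrite /= raddf_sum.
by apply: eq_bigr => j _; rewrite /= mcoeffZ -mpolyXD mcoeffX.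
Qed.

(** Off the diagonal the monomial collects the equal entries at [(i, j, l)] and [(j, i, l)], whence
    the multiplicity [(i != j).+1]. *)
Lemma eigenmx_xx T l i j : psym T ->
  eigenmx T l (idx (xvar i) (xvar j)) = T (i, j, l) *+ (i != j).+1.
Proof.
move=> symT; rewrite eigenmxE basis_mnm_idx mnmU2_eq.
rewrite ![lam == _]eq_sym !xvar_lam /= subr0 pair_bigA /=.
under eq_bigr => p _ do rewrite mnmU2_eq !(inj_eq xvar_inj) -!xpair_eqE -!surjective_pairing.
rewrite (bigD1 (i, j)) //= eqxx mulr1.
have [<-|ij] := eqVneq i j.
  by rewrite big1 ?addr0 // => p /negPf ->; rewrite mulr0.
rewrite (bigD1 (j, i)) /=; last by rewrite xpair_eqE eq_sym (negPf ij).
rewrite eqxx orbT mulr1 symT big1 ?addr0 // => p /andP [/negPf -> /negPf ->].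
by rewrite mulr0.
Qed.

Lemma eigenmx_xlam T : colsub col_xlam (eigenmx T) = - 1%:M.
Proof.
apply/matrixP => l i; rewrite [LHS]mxE eigenmxE col_xlamE basis_mnm_idx !mxE.
rewrite big1 => [|a _]; last first.
  by rewrite big1 // => b _; rewrite mnmU2_eq !xvar_lam andbF /= mulr0.
by rewrite sub0r mnmU2_eq eqxx (inj_eq xvar_inj) xvar_lam andbF.
Qed.

Lemma eigenmx_lamlam T l : eigenmx T l col_lamlam = 0.
Proof.
rewrite eigenmxE col_lamlamE basis_mnm_idx big1 => [|a _]; last first.
  by rewrite big1 // => b _; rewrite mnmU2_eq !xvar_lam /= mulr0.
by rewrite mnmU2_eq !xvar_lam !andbF subr0.
Qed.

Lemma eigenmx_section T : eigenmx T *m (- colsub col_xlam 1%:M) = 1%:M.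
Proof. by rewrite mulmxN mulmx_colsub mulmx1 eigenmx_xlam opprK. Qed.

Lemma grass_eigenplane T : grass 4 (eigenplane T).
Proof. by rewrite eigenplaneE; exact: grass_frame (eigenmx_section T). Qed.

Lemma eigenplane_lamlam T v : eigenplane T v -> v 0 col_lamlam = 0.
Proof.
rewrite eigenplaneE row_spanE => -[b _ <-].
by rewrite mxE big1 // => i _; rewrite eigenmx_lamlam mulr0.
Qed.

(** The matrix expressing one basis in terms of the other is 1, by comparing the blocks -1; the
    entries of the tensors then agree up to a factor 2, which [h] cancels. *)
Lemma eigenplane_inj (h : A) : h *+ 2 = 1 ->
  {in @psym A &, injective (@eigenplane A)}.
Proof.
move=> h2 T T' /set_mem symT /set_mem symT'; rewrite !eigenplaneE => TT'.
have [i|X TX] := @row_span_factor _ _ _ _ (eigenmx T) (eigenmx T').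
  by rewrite -TT'; exact: row_span_row.
have X1 : X = 1%:M.
  have := congr1 (colsub col_xlam) TX; rewrite -mulmx_colsub !eigenmx_xlam mulmxN mulmx1.
  by move/oppr_inj.
rewrite {}X1 mul1mx in TX.
apply/ffunP => -[[i j] l].
have := eigenmx_xx l i j symT; rewrite TX eigenmx_xx // => /esym.
case: eqP => //= _; rewrite -[_ *+ 2]mulr_natr -[X in _ = X]mulr_natr.
move/(congr1 (fun x => x * h)); rewrite -!mulrA.
by rewrite [2%:R * h]mulr_natl h2 !mulr1.
Qed.

Lemma eigenmx_surj (h : A) (N : 'M[A]_(4, 15)) : h *+ 2 = 1 ->
  colsub col_xlam N = - 1%:M -> (forall l, N l col_lamlam = 0) ->
  exists2 T, psym T & eigenmx T = N.
Proof.
move=> h2 Nxlam Nlamlam.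
(* Off-diagonal coefficients are halved, since the quadric counts each of them twice. *)
pose T : tensor A := [ffun p => N p.2 (idx (xvar p.1.1) (xvar p.1.2)) *
  (if p.1.1 == p.1.2 then 1 else h)].
have symT : psym T by move=> i j l; rewrite !ffunE /= idxC eq_sym.
exists T => //; apply/matrixP => l c; case: (colP c) => [i j|i|].
- rewrite eigenmx_xx // ffunE /=; case: eqP => _; first by rewrite mulr1.
  by rewrite -mulrnAr h2 mulr1.
- have /matrixP /(_ l i) := eigenmx_xlam T; rewrite -Nxlam.
  by rewrite [LHS]mxE [RHS]mxE.
- by rewrite eigenmx_lamlam Nlamlam.
Qed.

End EigenMatrix.

Lemma map_eigenmx (A B : comNzRingType) (f : {rmorphism A -> B}) (T : tensor A) :
  map_mx f (eigenmx T) = eigenmx (map_tensor f T).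
Proof.
apply/matrixP => l c; rewrite [LHS]mxE !eigenmxE rmorphB rmorph_nat rmorph_sum.
congr (_ - _); apply: eq_bigr => i _; rewrite rmorph_sum; apply: eq_bigr => j _.
by rewrite rmorphM rmorph_nat ffunE.
Qed.

Lemma base_change_eigenplane (A B : comNzRingType) (f : {rmorphism A -> B}) (T : tensor A) :
  base_change f (eigenplane T) = eigenplane (map_tensor f T).
Proof. by rewrite !eigenplaneE base_change_row_span map_eigenmx. Qed.

(** Both sides are linear in the form, so products of two variables suffice; on such a product only
    the column [idx i j] contributes. *)
Lemma eigenform_pairing (k : comNzRingType) (A : comAlgType k) (T : tensor k) l (v : 'rV[A]_5) :
  \sum_c coef_row (eigenform T l) 0 c *: veronese_vec v 0 c
  = mmap (in_alg A) (v 0) (eigenform T l).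
Proof.
pose L (p : {mpoly k[5]}) := \sum_c p@_(basis_mnm c) *: veronese_vec v 0 c.
have LX i j : L ('X_i * 'X_j) = mmap (in_alg A) (v 0) ('X_i * 'X_j).
  rewrite /L -mpolyXD mmapX /mmap1 -basis_mnm_idx (bigD1 (idx i j)) //=.
  rewrite mcoeffX eqxx scale1r [X in _ + X]big1 ?addr0 => [|c cij].
    by rewrite mxE.
  by rewrite mcoeffX (inj_eq basis_mnm_inj) eq_sym (negPf cij) scale0r.
transitivity (L (eigenform T l)); first by apply: eq_bigr => c _; rewrite mxE.
rewrite /eigenform mmapB -LX raddf_sum.
have LB p q : L (p - q) = L p - L q.
  by rewrite -sumrB; apply: eq_bigr => c _; rewrite mcoeffB scalerBl.
have LD p q : L (p + q) = L p + L q.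
  by rewrite -big_split; apply: eq_bigr => c _; rewrite mcoeffD scalerDl.
have L0 : L 0 = 0 by rewrite /L big1 // => c _; rewrite mcoeff0 scale0r.
have LZ a p : L (a *: p) = in_alg A a * L p.
  by rewrite mulr_algl scaler_sumr; apply: eq_bigr => c _; rewrite mcoeffZ scalerA.
rewrite LB; congr (_ - _); rewrite (big_morph L LD L0); apply: eq_bigr => i _.
rewrite (big_morph L LD L0) /= raddf_sum; apply: eq_bigr => j _.
by rewrite LZ LX /= mmapZ.
Qed.

(** * The column conditions and the isomorphism onto their locus *)

Lemma map_mx_rank (A B : comNzRingType) (f : {rmorphism A -> B}) n r (P : 'M[A]_n) :
  (forall (K : fieldType) (g : {rmorphism A -> K}), \rank (map_mx g P) = r) ->
  forall (K : fieldType) (g : {rmorphism B -> K}), \rank (map_mx g (map_mx f P)) = r.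
Proof. by move=> rP K g; rewrite -map_mx_comp; exact: (rP K (g \o f)). Qed.

(** Trades the quantification over representing matrices for a linear condition on [H], which can be
    checked on generators after base change. *)
Lemma zero_lamlamE (k : comNzRingType) (A : comAlgType k) (H : set 'rV[A]_15) :
  @zero_lamlam k A H <-> grass 4 H /\ forall v, H v -> v 0 col_lamlam = 0.
Proof.
by split=> -[gH h]; split => //; apply/(grass_zero_column col_lamlam gH).
Qed.

Lemma zero_lamlam_closed (k : comNzRingType) : is_closed_sub (@zero_lamlam k).
Proof.
split => [A H []//|A H gH]; exists [set v 0 col_lamlam | v in H] => B f.
rewrite zero_lamlamE; split => [[_ h] _ [v Hv <-]|h].
  have := h (map_mx f v); rewrite mxE; apply.
  by apply: span_incl; exists v.
split; first exact: grass_pull.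
move=> _ [m [b [M [hM ->]]]]; rewrite mxE big1 // => i _.
have [v Hv vM] := hM i.
have -> : M i col_lamlam = f (v 0 col_lamlam).
  by have /rowP /(_ col_lamlam) := vM; rewrite !mxE.
by rewrite h ?mulr0 //; exists v.
Qed.

Lemma nonzero_xlam_open (k : comNzRingType) : is_open_sub (@nonzero_xlam k).
Proof.
split => [A H []//|A H gH]; have [P [PP HE rP]] := gH.
exists [set \det (mxsub s col_xlam P) | s in [set: {ffun 'I_4 -> 'I_15}]] => B f.
have fgH : grass 4 (base_change f H) by exact: (@grass_pull k 15 4 A B f H gH).
have nzE := grass_plucker_nonzero col_xlam (map_mx_rank f rP).
rewrite -base_change_row_span -HE in nzE.
have minorE s : \det (mxsub s col_xlam (map_mx f P)) = f (\det (mxsub s col_xlam P)).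
  by rewrite -map_mxsub det_map_mx.
split => [[_ /nzE [b b1]]|[m [b [a [ha ba1]]]]].
  (* Openness asks for combinations indexed by an ordinal, so the row selections are enumerated. *)
  pose F := {ffun 'I_4 -> 'I_15}; pose s (i : 'I_#|F|) : F := enum_val i.
  exists #|F|, (fun i => b (s i)), (fun i => \det (mxsub (s i) col_xlam P)).
  split=> [i|]; first by exists (s i).
  rewrite -b1 -(big_enum_val (fun s : F => b s * f (\det (mxsub s col_xlam P)))) /=.
  by apply: eq_bigr => t _; rewrite minorE.
split => //; apply/nzE.
have /choice [s hs] : forall i, exists s : {ffun 'I_4 -> 'I_15},
    \det (mxsub s col_xlam P) = a i.
  by move=> i; have [s _ e] := ha i; exists s.
(* Several indices may name the same row selection, so their coefficients are added up. *)
exists (fun t => \sum_(i | s i == t) b i).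
rewrite -ba1 (partition_big s predT) //=; apply: eq_bigr => t _.
by rewrite mulr_suml; apply: eq_bigr => i /eqP <-; rewrite minorE hs.
Qed.

Lemma eigenplane_zero_lamlam (k : comNzRingType) (A : comAlgType k) (T : tensor A) :
  @zero_lamlam k A (eigenplane T).
Proof.
apply/zero_lamlamE; split; first exact: grass_eigenplane.
exact: eigenplane_lamlam.
Qed.

(** The rows of the eigenmatrix are combinations of those of [M], so the minor of [M] divides the
    determinant of the block -1, which is a sign. *)
Lemma eigenplane_nonzero_xlam (k : comNzRingType) (A : comAlgType k) (T : tensor A) :
  @nonzero_xlam k A (eigenplane T).
Proof.
split => [|K f M]; first exact: grass_eigenplane.
rewrite /represents base_change_eigenplane eigenplaneE => MT.
have [i|X XM] := @row_span_factor _ _ _ _ (eigenmx (map_tensor f T)) M.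
  by rewrite MT; exact: row_span_row.
have /(congr1 determinant) := eigenmx_xlam (map_tensor f T).
rewrite XM -mulmx_colsub det_mulmx -scaleN1r detZ det1 mulr1 => e.
apply: contra_eq_neq e => M0; rewrite [X in _ * X]M0 mulr0 eq_sym.
by rewrite signr_eq0.
Qed.

(* Cramer's rule: if [\sum_s b_s \det P_(s, J) = 1], the combination of the
   [\adj P_(s, J)] with coefficients [b_s] turns [P] into a basis of its row
   span with identity block in the columns [J]. *)
Lemma plucker_frame (A : comNzRingType) n r (P : 'M[A]_n) (J : 'I_r -> 'I_n)
    (b : {ffun 'I_r -> 'I_n} -> A) : P *m P = P ->
  (forall (K : fieldType) (f : {rmorphism A -> K}), \rank (map_mx f P) = r) ->
  \sum_s b s * \det (mxsub s J P) = 1 ->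
  exists2 N : 'M_(r, n), colsub J N = 1%:M & row_span N = row_span P.
Proof.
move=> PP rP b1.
pose C := \sum_s b s *: (\adj (mxsub s J P) *m rowsub s 1%:M).
have NJ : colsub J (C *m P) = 1%:M.
  rewrite -mulmx_colsub mulmx_suml.
  transitivity (\sum_s (b s * \det (mxsub s J P))%:M : 'M_r).
    apply: eq_bigr => s _; rewrite -scalemxAl -mulmxA mul_rowsub_mx mul1mx.
    have -> : rowsub s (colsub J P) = mxsub s J P.
      by apply/matrixP => i j; rewrite !mxE.
    by rewrite mul_adj_mx scale_scalar_mx.
  by rewrite -raddf_sum b1.
exists (C *m P) => //; apply/esym.
apply: (idempotent_frame (E := colsub J 1%:M) PP rP).
  by rewrite mulmx_colsub mulmx1.
by rewrite -mulmxA PP.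
Qed.

Lemma row_spanN (A : comNzRingType) m n (M : 'M[A]_(m, n)) : row_span (- M) = row_span M.
Proof.
rewrite !row_spanE; apply/seteqP; split => w [b _ <-]; exists (- b) => //.
  by rewrite mulNmx mulmxN.
by rewrite mulNmx mulmxN opprK.
Qed.

Lemma eigenplane_iso (k : comNzRingType) (h : k) : h *+ 2 = 1 ->
  is_iso_onto (X := Sym2T k) (Y := Gr k 15 4) (fun A => @eigenplane A)
    (fun A => @zero_lamlam k A `&` @nonzero_xlam k A).
Proof.
move=> h2 A; have {}h2 : (h%:A : A) *+ 2 = 1 by rewrite scalerMnl h2 scale1r.
split.
- by move=> T _; split; [exact: eigenplane_zero_lamlam | exact: eigenplane_nonzero_xlam].
- exact: eigenplane_inj h2.
- move=> H [/zero_lamlamE [[P [PP HE rP]] zeroH] [_ nzH]].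
  rewrite {}HE in zeroH nzH *.
  have /(grass_plucker_nonzero col_xlam rP) [b b1] := nzH.
  have [N NJ NP] := plucker_frame PP rP b1.
  (* [N] has the block 1 where an eigenmatrix has -1; negation keeps the row span. *)
  have [||T symT TN] := eigenmx_surj (N := - N) h2.
  + by apply/matrixP => i j; have /matrixP /(_ i j) := NJ; rewrite !mxE => ->.
  + move=> l; rewrite mxE.
    have := zeroH (row l N); rewrite mxE => ->; first by rewrite oppr0.
    by rewrite -NP; exact: row_span_row.
  by exists T => //; rewrite eigenplaneE TN row_spanN.
Qed.

Lemma eigenplane_morphism (k : comNzRingType) :
  is_morphism (X := Sym2T k) (Y := Gr k 15 4) (fun A => @eigenplane A).
Proof.
split => [A T _|A B f T _]; first exact: grass_eigenplane.
by rewrite /= base_change_eigenplane.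
Qed.

(** * The Veronese embedding *)

Section Veronese.

Variable A : comNzRingType.
Implicit Types (u v w : 'rV[A]_5) (P : 'M[A]_5).

Lemma veronese_vec_idx v i j : veronese_vec v 0 (idx i j) = v 0 i * v 0 j.
Proof.
rewrite mxE basis_mnm_idx -[LHS]/(mmap1 (v 0) _).
by rewrite commr_mmap1_M ?mmap1U // => a b; exact: mulrC.
Qed.

Lemma veronese_vecZ a v : veronese_vec (a *: v) = (a ^+ 2) *: veronese_vec v.
Proof.
apply/rowP => c; have [i [j ->]] := idx_surj c.
by rewrite [RHS]mxE !veronese_vec_idx !mxE expr2 mulrACA.
Qed.

(** Twice the symmetric product of [u] and [w], written through squares so that it lies in their
    span. *)
Definition polar u w := veronese_vec (u + w) - veronese_vec u - veronese_vec w.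

Lemma polar_idx u w i j :
  polar u w 0 (idx i j) = u 0 i * w 0 j + u 0 j * w 0 i.
Proof.
have subE (x y z : 'rV[A]_15) c : (x - y - z) 0 c = x 0 c - y 0 c - z 0 c.
  by rewrite !mxE.
by rewrite subE !veronese_vec_idx !mxE; ring.
Qed.

(* The matrix of [Sym^2 P]: the product [z_a z_b] of basis vectors goes to the
   product of the rows [a] and [b] of [P], that is, to half of their polar form. *)
Definition sym2mx (h : A) P : 'M[A]_15 :=
  \matrix_c \sum_(p : 'I_5 * 'I_5 | idx p.1 p.2 == c)
    h *: polar (row p.1 P) (row p.2 P).

Lemma sym2mxE h P c i j : sym2mx h P c (idx i j) =
  \sum_(p : 'I_5 * 'I_5 | idx p.1 p.2 == c)
    h * (P p.1 i * P p.2 j + P p.1 j * P p.2 i).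
Proof.
rewrite mxE summxE; apply: eq_bigr => p _.
by rewrite [LHS]mxE polar_idx !mxE.
Qed.

Lemma mulmx_sym2mx h P (z : 'rV_15) :
  z *m sym2mx h P = \sum_p (z 0 (idx p.1 p.2) * h) *: polar (row p.1 P) (row p.2 P).
Proof.
rewrite mulmx_sum_row [RHS](partition_big (fun p => idx p.1 p.2) predT) //=.
apply: eq_bigr => c _; rewrite rowK scaler_sumr.
by apply: eq_bigr => p /eqP ->; rewrite scalerA.
Qed.

Lemma veronese_vec_mulmx h P v : h *+ 2 = 1 ->
  veronese_vec (v *m P) = veronese_vec v *m sym2mx h P.
Proof.
move=> h2; rewrite mulmx_sym2mx; apply/rowP => c; have [i [j ->]] := idx_surj c.
(* Writing 1 as [h + h] splits the product into two halves, one for each order of the factors, to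
   match the symmetric polar form. *)
rewrite summxE veronese_vec_idx -[LHS]mul1r -h2 mulrnAl mulr2n.
pose S i j := \sum_p v 0 p.1 * v 0 p.2 * (P p.1 i * P p.2 j).
have SE a b : (v *m P) 0 a * (v *m P) 0 b = S a b.
  rewrite !mxE big_distrlr pair_bigA; apply: eq_bigr => p _ /=.
  by rewrite mulrACA.
rewrite -mulrDr {2}[_ * (v *m P) 0 j]mulrC !SE -big_split mulr_sumr.
apply: eq_bigr => p _; rewrite [RHS]mxE polar_idx veronese_vec_idx !mxE /=.
by rewrite -mulrDr mulrA [h * _]mulrC.
Qed.

(** The rows of [Q] are combinations of squares of vectors of the row span of [P], by polarization;
    [Q] fixes these squares because [P] fixes the vectors. Both claims follow. *)
Lemma veronese_row_span h P : h *+ 2 = 1 -> P *m P = P ->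
  sym2mx h P *m sym2mx h P = sym2mx h P /\
  veronese (row_span P) = row_span (sym2mx h P).
Proof.
move=> h2 PP; set Q := sym2mx h P; pose S := [set veronese_vec v | v in row_span P].
have rowQ c : span S (row c Q).
  rewrite rowK; apply: span_sum => p _; apply: spanZ.
  have inS v : row_span P v -> span S (veronese_vec v).
    by move=> Pv; apply: span_incl; exists v.
  rewrite /polar -![- veronese_vec _]scaleN1r.
  do 2?[apply: spanD]; do 2?[apply: spanZ]; apply: inS; try exact: row_span_row.
  apply: (@row_span_mul _ _ _ _ (delta_mx 0 p.1 + delta_mx 0 p.2)).
  rewrite row_spanE; exists 1%:M => //.
  by rewrite mul1mx mulmxDl -!rowE.
have SQ (w : 'rV_15) : span S w -> w *m Q = w.
  move=> [m [b [M [hM ->]]]]; rewrite -mulmxA; congr (_ *m _).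
  apply/row_matrixP => i; rewrite row_mul; have [v Pv <-] := hM i.
  rewrite -veronese_vec_mulmx //; move: Pv; rewrite row_spanE => -[x _ <-].
  by rewrite -mulmxA PP.
split; first by apply/row_matrixP => c; rewrite row_mul SQ.
apply/seteqP; split; last exact: row_span_sub_span.
by move=> w Sw; rewrite row_spanE; exists w => //; exact: SQ.
Qed.

End Veronese.

Lemma map_sym2mx (A B : comNzRingType) (f : {rmorphism A -> B}) h P :
  map_mx f (sym2mx h P) = sym2mx (f h) (map_mx f P).
Proof.
apply/matrixP => c d; have [i [j ->]] := idx_surj d.
rewrite [LHS]mxE !sym2mxE rmorph_sum; apply: eq_bigr => p _.
by rewrite rmorphM rmorphD !rmorphM !mxE.
Qed.

(** If [W] spans the line, [veronese_vec W] spans the image, and it is nonzero because it has the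
    squares of the coordinates of [W] among its own. *)
Lemma mxrank_sym2mx (K : fieldType) (h : K) (P : 'M[K]_5) :
  h *+ 2 = 1 -> P *m P = P -> \rank P = 1%N -> \rank (sym2mx h P) = 1%N.
Proof.
move=> h2 PP rP; have [_ verP] := veronese_row_span h2 PP.
have [W WP] := exists_frame_field rP.
have rW : \rank W = \rank P.
  apply/eqP; rewrite eqn_leq; apply/andP; split; apply: mxrankS; apply/row_subP => i;
    apply/row_span_fieldE; [rewrite -WP | rewrite WP]; exact: row_span_row.
have W0 : W != 0 by rewrite -mxrank_eq0 rW rP.
have : (veronese_vec W == sym2mx h P)%MS.
  apply/andP; split.
    apply/row_span_fieldE; rewrite -verP; apply: span_incl; exists W => //.
    by rewrite -WP -{2}(row_id 0 W); exact: row_span_row.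
  apply/row_subP => c; apply/row_span_fieldE.
  apply: (@span_sub_row_span _ _ _ [set veronese_vec v | v in row_span P]).
    move=> _ [v + <-]; rewrite -WP row_spanE => -[b _ <-].
    rewrite [b]mx11_scalar mul_scalar_mx veronese_vecZ row_spanE.
    by exists (b 0 0 ^+ 2)%:M => //; rewrite mul_scalar_mx.
  by rewrite -/(veronese _) verP; exact: row_span_row.
move/eqmxP => <-; rewrite rank_rV; apply/eqP; rewrite eqb1.
have [i Wi] : exists i, W 0 i != 0.
  apply/existsP; rewrite -negb_forall; apply: contra W0 => /forallP W0.
  by apply/eqP/rowP => i; rewrite mxE; apply/eqP.
apply: contra Wi => /eqP /rowP /(_ (idx i i)); rewrite veronese_vec_idx mxE.
by move/eqP; rewrite mulf_eq0 orbb.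
Qed.

Lemma grass_veronese (A : comNzRingType) (h : A) (L : set 'rV[A]_5) :
  h *+ 2 = 1 -> grass 1 L -> grass 1 (veronese L).
Proof.
move=> h2 [P [PP -> rP]]; have [QQ ->] := veronese_row_span h2 PP.
exists (sym2mx h P); split => // K f; rewrite map_sym2mx mxrank_sym2mx ?rP //.
  by rewrite -rmorphMn h2 rmorph1.
by rewrite -map_mxM PP.
Qed.

(** By [eigenform_pairing] the two conditions agree on the generators [veronese_vec v] and
    [coef_row (eigenform T l)]; bilinearity extends this to the spans. *)
Lemma veronese_dual_plane (k : comNzRingType) (h : k) (T : tensor k)
    (A : comAlgType k) (L : set 'rV[A]_5) : h *+ 2 = 1 -> grass 1 L ->
  @dual_plane k (eigenplane T) A (veronese L) <-> @eigenscheme k T A L.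
Proof.
move=> h2 gL; have {}h2 : (h%:A : A) *+ 2 = 1 by rewrite scalerMnl h2 scale1r.
split=> -[_ LT]; split => //.
- move=> v Lv l; rewrite -eigenform_pairing; apply: LT.
    by apply: span_incl; exists v.
  by apply: span_incl; exists l.
- exact: grass_veronese h2 gL.
move=> z [m [b [M [hM ->]]]] _ [n [c [N [hN ->]]]].
have MN i j : \sum_d N j d *: M i d = 0.
  have [v Lv vM] := hM i; have [l _ lN] := hN j; rewrite -[RHS](LT v Lv l).
  rewrite -eigenform_pairing vM lN; apply: eq_bigr => d _.
  by rewrite !mxE.
transitivity (\sum_j \sum_i c 0 j *: (b 0 i * \sum_d N j d *: M i d)); last first.
  by rewrite big1 // => j _; rewrite big1 // => i _; rewrite MN mulr0 scaler0.
transitivity (\sum_d \sum_j \sum_i c 0 j *: (b 0 i * (N j d *: M i d))).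
  apply: eq_bigr => d _; rewrite !mxE scaler_suml; apply: eq_bigr => j _.
  rewrite scaler_sumr; apply: eq_bigr => i _.
  by rewrite -scalerAr scalerA.
rewrite exchange_big; apply: eq_bigr => j _; rewrite exchange_big.
by apply: eq_bigr => i _; rewrite -scaler_sumr -mulr_sumr.
Qed.

Theorem theorem5p1 (R : realType) :
  [/\ is_morphism (X := Sym2T R[i]) (Y := Gr R[i] 15 4)
        (fun A => @eigenplane A),
      is_closed_sub (@zero_lamlam R[i]),
      is_open_sub (@nonzero_xlam R[i]),
      is_iso_onto (X := Sym2T R[i]) (Y := Gr R[i] 15 4)
        (fun A => @eigenplane A)
        (fun A => @zero_lamlam R[i] A `&` @nonzero_xlam R[i] A) &
      forall T : tensor R[i], psym T -> forall A : comAlgType R[i],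
        [set veronese L | L in @eigenscheme R[i] T A] =
        @dual_plane R[i] (eigenplane T) A
          `&` [set veronese L | L in points (Gr R[i] 5 1) A]].
Proof.
(* Characteristic 0 provides the half [h] used throughout. *)
have h2 : (2%:R^-1 : R[i]) *+ 2 = 1.
  by rewrite -[LHS]mulr_natr mulVf // Num.Theory.pnatr_eq0.
split.
- exact: eigenplane_morphism.
- exact: zero_lamlam_closed.
- exact: nonzero_xlam_open.
- exact: eigenplane_iso h2.
- move=> T _ A; apply/seteqP; split => [_ [L EL <-]|H [DL [L gL LE]]].
    have gL := EL.1; split; last by exists L.
    exact/(veronese_dual_plane T h2 gL).
  by exists L => //; apply/(veronese_dual_plane T h2 gL); rewrite LE.
Qed.
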